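(* Let $G$ be a cycle graph of order $n\geq 4$ and let $D$ be a minimum fixing set of $G$. For each $v\in D$, the fixing share is $f(v;D)=\frac{1}{2}\binom{n}{2}$. Moreover, $F_{sum}(D)=\binom{n}{2}$ and $F\%(D)=\frac{4}{n^2-n}$.
   Context: Graphs are finite, simple and undirected, with vertex set $V(G)$; the order of $G$ is $|V(G)|$. $\Gamma(G)$ is the automorphism group of $G$, and for a vertex $x$, $\Gamma_x(G)=\{g\in\Gamma(G): g(x)=x\}$ is its stabilizer. A set $D\subseteq V(G)$ is a fixing set of $G$ if the only automorphism $g$ with $g(x)=x$ for all $x\in D$ is the identity; a minimum fixing set is a fixing set of minimum cardinality. The orbit of $v$ is $\mathcal{O}(v)=\{g(v): g\in\Gamma(G)\}$. $V_s(G)$ denotes the set of unordered pairs $(u,v)$ of vertices with $u\neq v$ and $\mathcal{O}(u)=\mathcal{O}(v)$. A vertex $x$ fixes a pair $(u,v)\in V_s(G)$ if for every $h\in\Gamma_x(G)$ we have $h(u)\neq v$ or $h(v)\neq u$. The fixed neighborhood of $x$ is $F(x)=\{(u,v)\in V_s(G): x \text{ fixes } (u,v)\}$. Let $G$ be connected and $D$ a minimum fixing set of $G$. For $x\in D$ and $(u,v)\in F(x)$, put $\mathcal{F}(u,v)=\{F(y): y\in D \text{ and } (u,v)\in F(y)\}$. The fixing share of $x\in D$ in $D$ is $$f(x;D)=\sum_{(u,v)\in F(x)}\frac{1}{|\mathcal{F}(u,v)|}.$$ The fixing sum and fixing percentage of $G$ with respect to $D$ are $F_{sum}(D)=\sum_{x\in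 D}f(x;D)$ and $F\%(D)=\frac{|D|}{F_{sum}(D)}$. *)

(* Defs.v *)
From HB Require Import structures.
From mathcomp Require Import all_boot all_order all_algebra all_fingroup.

Set Implicit Arguments.
Unset Strict Implicit.
Unset Printing Implicit Defensive.

Import GRing.Theory.

Record sgraph := SGraph {
  vertex :> finType;
  adj : rel vertex;
  adj_sym : symmetric adj;
  adj_irrefl : irreflexive adj }.

Section Fixing.
Variable G : sgraph.
Implicit Types (x y u v : G) (D : {set G}).

Definition graph_aut : {set {perm G}} :=
  [set g : {perm G} | [forall x, forall y, adj (g x) (g y) == adj x y]].

Lemma graph_autP (g : {perm G}) :
  reflect (forall x y, adj (g x) (g y) = adj x y) (g \in graph_aut).
Proof.
rewrite inE; apply: (iffP forallP) => [gP x y | gP x].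
  by have /forallP/(_ y)/eqP := gP x.
by apply/forallP => y; rewrite gP.
Qed.

Lemma graph_aut_group_set : group_set graph_aut.
Proof.
apply/group_setP; split; first by apply/graph_autP => x y; rewrite !perm1.
move=> g h /graph_autP gP /graph_autP hP.
by apply/graph_autP => x y; rewrite !permM hP gP.
Qed.

Canonical graph_aut_group := Group graph_aut_group_set.

Definition fixing_set D : Prop :=
  forall g, g \in graph_aut -> (forall x, x \in D -> g x = x) -> g = 1%g.

Definition min_fixing_set D : Prop :=
  fixing_set D /\ forall D' : {set G}, fixing_set D' -> #|D| <= #|D'|.

(* An unordered pair of distinct vertices is a two-element set. *)
Definition Vs : {set {set G}} :=
  [set [set u; v] | u in G, v in G &
     (u != v) && (orbit 'P graph_aut u == orbit 'P graph_aut v)].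

Definition fixes x u v : bool :=
  [forall h in ('C_graph_aut[x | 'P])%g, (h u != v) || (h v != u)].

Lemma fixesC x u v : fixes x u v = fixes x v u.
Proof. by apply: eq_forallb => h; rewrite orbC. Qed.

(* By fixesC, membership of a pair does not depend on the order chosen. *)
Definition fixed_nbhd x : {set {set G}} :=
  [set [set u; v] | u in G, v in G & ([set u; v] \in Vs) && fixes x u v].

(* A set of neighborhoods, not a family indexed by D: coinciding fixed
   neighborhoods of distinct vertices of D are counted once. *)
Definition fixed_nbhds D (p : {set G}) : {set {set {set G}}} :=
  [set fixed_nbhd y | y in D & p \in fixed_nbhd y].

Local Open Scope ring_scope.

Definition fixing_share D x : rat :=
  \sum_(p in fixed_nbhd x) (#|fixed_nbhds D p|%:R)^-1.

Definition fixing_sum D : rat := \sum_(x in D) fixing_share D x.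

Definition fixing_percentage D : rat := #|D|%:R / fixing_sum D.

End Fixing.

(* ordS is the cyclic successor i |-> i.+1 %% n on 'I_n. *)
Definition cycle_adj n : rel 'I_n :=
  fun i j => (j == ordS i) || (i == ordS j).

(* G is isomorphic to the cycle on 'I_n.  For n < 3 cycle_adj n is not the
   adjacency of a simple cycle; the predicate is meant for n >= 3. *)
Definition is_cycle_graph n (G : sgraph) : Prop :=
  exists f : 'I_n -> G,
    bijective f /\ forall i j, adj (f i) (f j) = cycle_adj i j.

(* Main.v *)
Require Import Defs.
From mathcomp Require Import all_boot all_order all_algebra all_fingroup.
From mathcomp Require Import ring.

(** The count of pairs fixed by a single vertex never has to be computed.

    Identify the vertices of the cycle with the integers mod n.  For every
    residue s the map z |-> s - z is an automorphism, the reflection of sum s;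
    the one of sum u + v exchanges u and v.  So the cycle is vertex-transitive,
    every pair of distinct vertices belongs to Vs, and #|Vs| = 'C(n, 2).
    An automorphism is determined by its values at two adjacent vertices
    ([aut_fix_edge]), so the stabilizer of x consists of 1 and the reflection of
    sum x + x ([stabilizer_cycle]).  This reflection is not the identity,
    whereas two adjacent vertices form a fixing set: hence D = {x, y}
    with x != y.

    Let A and B be the fixed neighborhoods of x and y.
    - A and B cover Vs: a pair {u, v} outside both has
      u + v = x + x = y + y, so the reflection about x fixes y as well,
      contradicting that D is a fixing set.
    - A != Vs, because the two neighbors of x are exchanged by the reflection
      about x; as A and B cover Vs, it follows that A != B.
    - #|A| = #|B|, because some automorphism maps x to y.
    In the fixing share of x a pair of A counts 1, or 1/2 if it lies in B as
    well.  The share is therefore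
      #|A| - #|A :&: B| / 2 = (#|A| + #|B| - #|A :&: B|) / 2 = #|A :|: B| / 2,
    which is half of #|Vs| ([fixing_share_pair]).  The fixing sum and the
    percentage follow. *)

Import GRing.Theory.
Local Open Scope ring_scope.

(** * Fixed neighborhoods in an arbitrary graph *)

Section Neighborhoods.
Context {G : sgraph}.
Implicit Types (x y u v : G) (p : {set G}).

Lemma set2_eq {T : finType} {a b u v : T} : u != v ->
  [set a; b] = [set u; v] -> a = u /\ b = v \/ a = v /\ b = u.
Proof.
move=> uv e; have /setP e' := e.
have := e' u; have := e' v; rewrite !inE !eqxx orbT /=.
case/orP => /eqP ?; case/orP => /eqP ?; subst; rewrite ?eqxx // in uv *; auto.
Qed.

Lemma in_Vs u v :
  ([set u; v] \in Vs G) =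
  (u != v) && (orbit 'P (graph_aut G) u == orbit 'P (graph_aut G) v).
Proof.
apply/imset2P/idP => [[a b _]|uvP]; last by exists u v; rewrite ?inE.
rewrite inE => /and3P[_ ab o] /(set2_eq ab)[][-> ->]; first by rewrite ab.
by rewrite eq_sym ab eq_sym.
Qed.

Lemma in_fixed_nbhd x u v :
  ([set u; v] \in fixed_nbhd x) = ([set u; v] \in Vs G) && fixes x u v.
Proof.
apply/imset2P/idP => [[a b _]|uvP]; last by exists u v; rewrite ?inE.
rewrite inE => /and3P[_ abV fx] e; rewrite e abV.
move: abV; rewrite in_Vs => /andP[ab _].
by case: (set2_eq ab e) => -[-> ->] //; rewrite fixesC.
Qed.

Lemma fixed_nbhd_sub x : fixed_nbhd x \subset Vs G.
Proof.
by apply/subsetP => p /imset2P[a b _]; rewrite inE => /and3P[_ ? _] ->.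
Qed.

Lemma fixesPn {x u v} :
  reflect (exists h : {perm G},
             [/\ h \in graph_aut G, h x = x, h u = v & h v = u])
          (~~ fixes x u v).
Proof.
rewrite negb_forall; apply: (iffP existsP) => -[h].
  rewrite negb_imply negb_or !negbK !inE /= => /andP[/andP[hA]].
  rewrite sub1set inE => /eqP hx /andP[/eqP hu /eqP hv].
  by exists h; split=> //; rewrite inE.
case=> hA hx hu hv; exists h.
rewrite negb_imply negb_or !negbK hu hv !eqxx !andbT in_setI hA.
by apply/astab1P.
Qed.

Lemma fixes_aut (g : {perm G}) x u v : g \in graph_aut G ->
  fixes (g x) (g u) (g v) = fixes x u v.
Proof.
move=> gA; apply/negb_inj; apply/fixesPn/fixesPn => -[h [hA hx hu hv]].
  exists (g * (h * g^-1))%g; split; rewrite ?permM ?hx ?hu ?hv ?permK //.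
  by rewrite !groupM ?groupV.
exists (g^-1 * (h * g))%g; split; rewrite ?permM ?permK ?hx ?hu ?hv //.
by rewrite !groupM ?groupV.
Qed.

Lemma orbit_aut (g : {perm G}) u : g \in graph_aut G ->
  orbit 'P (graph_aut G) (g u) = orbit 'P (graph_aut G) u.
Proof.
by move=> gA; apply/orbit_in_eqP; rewrite ?subsetT // -[g u]/('P%act u g) mem_orbit.
Qed.

(** Transport of pairs by g is injective.  Applied to the inverse of g, the
    inequality becomes an equality. *)
Lemma leq_card_fixed_nbhd (g : {perm G}) x : g \in graph_aut G ->
  (#|fixed_nbhd x| <= #|fixed_nbhd (g x)|)%N.
Proof.
move=> gA; rewrite -(card_imset _ (imset_inj (@perm_inj _ g))).
apply/subset_leq_card/subsetP => _ /imsetP[_ /imset2P[u v _ + ->] ->].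
rewrite inE => /and3P[_ uvV fx].
rewrite imsetU !imset_set1 in_fixed_nbhd fixes_aut // fx andbT.
by move: uvV; rewrite !in_Vs !orbit_aut // (inj_eq perm_inj).
Qed.

Lemma card_fixed_nbhd_aut (g : {perm G}) x : g \in graph_aut G ->
  #|fixed_nbhd (g x)| = #|fixed_nbhd x|.
Proof.
move=> gA; apply/eqP; rewrite eqn_leq leq_card_fixed_nbhd // andbT.
by rewrite -{2}(permK g x) leq_card_fixed_nbhd ?groupV.
Qed.

(** A pair in both neighborhoods has weight 1/2 because the two neighborhoods
    differ; were they equal, they would count as one and its weight would
    be 1. *)
Lemma fixing_share_pair x y :
  fixed_nbhd x != fixed_nbhd y -> #|fixed_nbhd x| = #|fixed_nbhd y| ->
  fixing_share [set x; y] x = 1 / 2 * #|fixed_nbhd x :|: fixed_nbhd y|%:R.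
Proof.
set A := fixed_nbhd x; set B := fixed_nbhd y => AB cAB.
have weight p : p \in A ->
    #|fixed_nbhds [set x; y] p|%:R^-1 = 1 - (p \in B)%:R / 2 :> rat.
  move=> pA; have -> : fixed_nbhds [set x; y] p
      = if p \in B then [set A; B] else [set A].
    apply/setP => C; apply/imsetP/idP => [[z]|].
      rewrite !inE => /andP[/orP[]/eqP-> pz ->]; last by rewrite pz !inE eqxx orbT.
      by case: ifP => _; rewrite !inE eqxx.
    have xP : exists2 z, z \in [set z in [set x; y] | p \in fixed_nbhd z]
                       & A = fixed_nbhd z.
      by exists x; rewrite // !inE eqxx.
    case: ifP => pB; rewrite !inE; last by move=> /eqP->.
    by case/orP => /eqP-> //; exists y; rewrite // !inE eqxx orbT.
  case: ifP => _; first by rewrite cards2 AB; apply/eqP.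
  by rewrite cards1; apply/eqP.
rewrite /fixing_share (eq_bigr _ weight) sumrB sumr_const -mulr_suml.
have -> : \sum_(p in A) (p \in B)%:R = #|A :&: B|%:R :> rat.
  rewrite -sum1_card natr_sum (big_setID B) /= [X in _ + X]big1 ?addr0.
    by apply: eq_bigr => p; rewrite inE => /andP[_ ->].
  by move=> p; rewrite inE => /andP[/negbTE-> _].
have /(congr1 (fun k : nat => k%:R : rat)) := cardsUI A B.
rewrite !natrD -cAB => /(canRL (addrK _)) ->.
by field.
Qed.

End Neighborhoods.

(** * Automorphisms of the cycle *)

Section Cycle.
(* [c] numbers the vertices around the cycle; p > 2 makes 1 + 1 nonzero, so
   that the two neighbors of a vertex are distinct. *)
Context {G : sgraph} {p : nat} {f : 'Z_p -> G} {c : G -> 'Z_p}.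
Hypotheses (p_gt2 : (2 < p)%N) (fK : cancel f c) (cK : cancel c f).
Hypothesis adjE : forall x y : G, adj x y = (c y == c x + 1) || (c x == c y + 1).
Implicit Types (x y u v : G) (s : 'Z_p).

Let c_inj : injective c := can_inj cK.

Lemma two_neq0 : 1 + 1 != 0 :> 'Z_p.
Proof. by case: p p_gt2 => [|[|[|m]]]. Qed.

Lemma reflection_subproof s : injective (fun z => f (s - c z)).
Proof. by move=> x y /(can_inj fK)/addrI/oppr_inj/c_inj. Qed.

Definition reflection s : {perm G} := perm (@reflection_subproof s).

Lemma reflectionE s x : c (reflection s x) = s - c x.
Proof. by rewrite permE fK. Qed.

Lemma reflection_aut s : reflection s \in graph_aut G.
Proof.
apply/graph_autP => x y; rewrite !adjE !reflectionE orbC.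
by congr (_ || _); rewrite -subr_eq0 -[RHS]subr_eq0; congr (_ == 0); ring.
Qed.

Lemma reflection_swap u v : reflection (c u + c v) u = v.
Proof. by apply: c_inj; rewrite reflectionE addrC addKr. Qed.

Lemma reflectionK s : (reflection s * reflection s = 1)%g.
Proof.
by apply/permP => x; apply: c_inj; rewrite permM perm1 !reflectionE; ring.
Qed.

Lemma reflection_neq1 x : reflection (c x + c x) != 1%g.
Proof.
apply/eqP => /permP/(_ (f (c x + 1)))/(congr1 c).
rewrite perm1 reflectionE fK => /eqP; rewrite -subr_eq0.
have -> : c x + c x - (c x + 1) - (c x + 1) = - (1 + 1) by ring.
by rewrite oppr_eq0 (negbTE two_neq0).
Qed.

(** Walking around the cycle from a fixed edge, the next vertex is sent to a
    neighbor of the last fixed vertex, and one of its two neighbors is already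
    taken. *)
Lemma aut_fix_edge (g : {perm G}) x y : g \in graph_aut G ->
  c y = c x + 1 -> g x = x -> g y = y -> g = 1%g.
Proof.
move=> /graph_autP gA cy gx gy.
have step k : g (f (c x + k%:R)) = f (c x + k%:R)
           /\ g (f (c x + k.+1%:R)) = f (c x + k.+1%:R).
  elim: k => [|k [IH0 IH1]]; first by rewrite addr0 cK -cy cK.
  split=> //; have := gA (f (c x + k.+1%:R)) (f (c x + k.+2%:R)).
  rewrite IH1 !adjE !fK.
  rewrite -[c x + _ + 1]addrA natr1 eqxx /= => /orP[] /eqP e.
    by apply: c_inj; rewrite e fK.
  have gk : g (f (c x + k.+2%:R)) = g (f (c x + k%:R)).
    rewrite IH0; apply: c_inj; rewrite fK; apply: (addIr 1).
    by rewrite -e -addrA natr1.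
  have /eqP := can_inj fK (perm_inj gk).
  rewrite -[k.+2%:R]natr1 -natr1 -subr_eq0.
  have -> : c x + (k%:R + 1 + 1) - (c x + k%:R) = 1 + 1 by ring.
  by rewrite (negbTE two_neq0).
apply/permP => z; rewrite perm1.
have [+ _] := step (c z - c x : 'Z_p).
by rewrite natr_Zp addrC subrK cK.
Qed.

(** An automorphism fixing x sends the successor of x to one of the two neighbors
    of x; composed with the reflection about x if necessary, it fixes an edge. *)
Lemma stabilizer_cycle (h : {perm G}) x : h \in graph_aut G -> h x = x ->
  h = 1%g \/ h = reflection (c x + c x).
Proof.
move=> hA hx; set y := f (c x + 1).
have cy : c y = c x + 1 by rewrite fK.
have /graph_autP/(_ x y) := hA; rewrite hx !adjE cy eqxx /= => /orP[] /eqP e.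
  by left; apply: (aut_fix_edge h x y) => //; apply: c_inj; rewrite e.
right; set r := reflection _.
have hr : (h * r)%g = 1%g.
  apply: (aut_fix_edge _ x y) => //; first by rewrite groupM ?reflection_aut.
    by rewrite permM hx reflection_swap.
  apply: c_inj; rewrite permM reflectionE cy e; ring.
by rewrite -[h]mulg1 -(reflectionK (c x + c x)) mulgA hr mul1g.
Qed.

(** Only the reflection about x can exchange u and v while fixing x, and it does
    so exactly when its sum is c u + c v. *)
Lemma not_fixes_cycle x u v : u != v ->
  ~~ fixes x u v = (c u + c v == c x + c x).
Proof.
move=> uv; apply/fixesPn/eqP => [[h [hA hx hu hv]]|e].
  case: (stabilizer_cycle h x hA hx) => hE; subst h.
    by rewrite perm1 in hu; rewrite hu eqxx in uv.
  by rewrite -hu reflectionE addrC subrK.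
exists (reflection (c x + c x)); rewrite reflection_aut; split=> //.
- exact: reflection_swap.
- by rewrite -e reflection_swap.
- by rewrite -e addrC reflection_swap.
Qed.

(** * Minimum fixing sets of the cycle *)

Lemma Vs_cycle : Vs G = [set A : {set G} | #|A| == 2].
Proof.
apply/setP => A; rewrite inE; apply/idP/cards2P => [|[u [v [uv ->]]]].
  move=> AV; case/imset2P: (AV) => u v _ _ AE; exists u, v.
  by move: AV; rewrite AE in_Vs => /andP[].
by rewrite in_Vs uv -{1}(reflection_swap v u) orbit_aut ?reflection_aut ?eqxx.
Qed.

Lemma card_Vs_cycle : #|Vs G| = 'C(p, 2).
Proof.
have cardG : #|G| = p.
  by rewrite -(bij_eq_card (Bijective fK cK)) card_ord Zp_cast // ltnW.
by rewrite Vs_cycle card_draws cardG.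
Qed.

(** One vertex is not enough because the reflection about it is not the
    identity; two adjacent vertices are, by rigidity.  The last conclusion says
    that x and y are not antipodal: antipodal vertices have the same
    reflection. *)
Lemma min_fixing_set_cycle (D : {set G}) : min_fixing_set D ->
  exists x y, [/\ x != y, D = [set x; y] & c x + c x != c y + c y].
Proof.
case=> Dfix Dmin.
have D2 : #|D| == 2.
  rewrite eqn_leq; apply/andP; split.
    apply: leq_trans (Dmin [set f 0; f 1] _) _; last first.
      by rewrite cards2; case: (_ == _).
    move=> g gA gD; apply: (aut_fix_edge g (f 0) (f 1)) => //.
    - by rewrite !fK add0r.
    - by apply: gD; rewrite !inE eqxx.
    - by apply: gD; rewrite !inE eqxx orbT.
  rewrite ltnNge; apply/negP => /card_le1P D1.
  (* the default [f 0] only matters when D is empty *)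
  pose x := odflt (f 0) [pick z in D].
  case/eqP: (reflection_neq1 x); apply: Dfix (reflection_aut _) _ => z zD.
  suff -> : z = x by rewrite reflection_swap.
  rewrite /x; case: pickP => [w wD /=|/(_ z)]; last by rewrite zD.
  by have := D1 w wD z; rewrite zD inE => /esym/eqP.
have /cards2P[x [y [xy DE]]] := D2; exists x, y; split=> //.
apply/eqP => e; case/eqP: (reflection_neq1 x).
apply: Dfix (reflection_aut _) _ => z; rewrite DE !inE => /orP[] /eqP->.
  exact: reflection_swap.
by rewrite e reflection_swap.
Qed.

Lemma card_fixed_nbhd_cycle x y : #|fixed_nbhd x| = #|fixed_nbhd y|.
Proof.
by rewrite -(reflection_swap x y) card_fixed_nbhd_aut ?reflection_aut.
Qed.

Lemma fixed_nbhdU_cycle x y : c x + c x != c y + c y ->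
  fixed_nbhd x :|: fixed_nbhd y = Vs G.
Proof.
move=> xy; apply/eqP; rewrite eqEsubset subUset !fixed_nbhd_sub /=.
apply/subsetP => A AV; move: (AV); rewrite Vs_cycle inE.
case/cards2P => u [v [uv AE]]; rewrite AE in AV *.
rewrite inE !in_fixed_nbhd AV /= -[fixes x u v]negbK -[fixes y u v]negbK.
rewrite !not_fixes_cycle // -negb_and.
by apply: contraNN xy => /andP[/eqP<- /eqP<-].
Qed.

Lemma fixed_nbhd_proper_cycle x : fixed_nbhd x != Vs G.
Proof.
pose u := f (c x + 1); pose v := f (c x - 1).
have uv : u != v.
  apply: contraNneq two_neq0 => /(can_inj fK)/addrI/eqP.
  by rewrite -addr_eq0.
have sum_uv : c u + c v = c x + c x by rewrite !fK; ring.
apply/eqP => /setP/(_ [set u; v]).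
rewrite in_fixed_nbhd {2}Vs_cycle inE cards2 uv eqxx => /andP[_].
by apply/negP; rewrite not_fixes_cycle // sum_uv.
Qed.

Lemma fixing_share_cycle x y : c x + c x != c y + c y ->
  fixing_share [set x; y] x = 1 / 2 * 'C(p, 2)%:R.
Proof.
move=> xy; rewrite fixing_share_pair ?fixed_nbhdU_cycle ?card_Vs_cycle //.
  apply: contraNneq (fixed_nbhd_proper_cycle x) => e.
  by rewrite -(fixed_nbhdU_cycle x y xy) -e setUid.
exact: card_fixed_nbhd_cycle.
Qed.

End Cycle.

Lemma is_cycle_graphP (m : nat) (G : sgraph) : is_cycle_graph m.+3 G ->
  exists (f : 'Z_m.+3 -> G) (c : G -> 'Z_m.+3),
    [/\ cancel f c, cancel c f &
        forall x y : G, adj x y = (c y == c x + 1) || (c x == c y + 1)].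
Proof.
case=> f [[c fK cK] fadj]; exists f, c; split=> // x y.
have ordSE (i : 'Z_m.+3) : ordS i = i + 1.
  by apply: val_inj; rewrite /= addn1.
by rewrite -{1}(cK x) -{1}(cK y) fadj /cycle_adj !ordSE.
Qed.

Theorem theorem3p10 (n : nat) (G : sgraph) (D : {set G}) :
  (4 <= n)%N -> is_cycle_graph n G -> min_fixing_set D ->
  [/\ forall v : G, v \in D -> fixing_share D v = 1 / 2 * 'C(n, 2)%:R,
      fixing_sum D = 'C(n, 2)%:R
    & fixing_percentage D = 4 / (n%:R ^+ 2 - n%:R)].
Proof.
case: n => [|[|[|m]]] // _ /is_cycle_graphP[f [c [fK cK adjE]]] Dmin.
have p_gt2 : (2 < m.+3)%N by [].
have [x [y [xy DE sums]]] := min_fixing_set_cycle p_gt2 fK cK adjE D Dmin.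
have share v : v \in D -> fixing_share D v = 1 / 2 * 'C(m.+3, 2)%:R.
  have shareP := fixing_share_cycle p_gt2 fK cK adjE.
  rewrite DE !inE => /orP[] /eqP->; first exact: shareP.
  by rewrite setUC; apply: shareP; rewrite eq_sym.
have D2 : #|D| = 2 by rewrite DE cards2 xy.
have sumE : fixing_sum D = 'C(m.+3, 2)%:R.
  by rewrite /fixing_sum (eq_bigr _ share) sumr_const D2; field.
split=> //; rewrite /fixing_percentage sumE D2.
have binE : 'C(m.+3, 2)%:R * 2 = m.+3%:R ^+ 2 - m.+3%:R :> rat.
  rewrite -[2]/((2`!)%:R) -natrM bin_ffact ffactnS ffactn1 natrM /=.
  by rewrite -[m.+3%:R]natr1; ring.
have bin_neq0 : 'C(m.+3, 2)%:R != 0 :> rat.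
  by rewrite Num.Theory.pnatr_eq0 -lt0n bin_gt0.
by rewrite -binE; field.
Qed.
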